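(* There exist absolute constants $c,C>0$ such that the following holds. Let $N\ge2$, $n=N^2$, $\sigma>0$, $\delta\in(0,1)$, $\theta^*\in\mathbb{R}^{N\times N}$ (identified with $\mathbb{R}^n$), and $y=\theta^*+\varepsilon$ with $\varepsilon\sim\mathcal N(0,\sigma^2I_n)$. Let $\theta^\uparrow$ be the (Euclidean) projection of $\theta^*$ onto the set $\mathcal M$ of bi-isotonic matrices. Let $\lambda=c\,\sigma\sqrt{(\log n)\log(en/\delta)}/n$ and $$\hat\theta\in\operatorname*{argmin}_{\theta\in\mathbb{R}^n}\ \frac1n\|\theta-y\|_2^2+\lambda\|D\theta\|_1,$$ where $D$ is the incidence matrix of the $N\times N$ two-dimensional grid. Then, with probability at least $1-2\delta$, $$\frac1n\|\hat\theta-\theta^*\|_2^2\le\frac1n\|\theta^\uparrow-\theta^*\|_2^2+C\sigma\sqrt{\frac{(\log n)\log(n/\delta)}{n}}\,\sqrt{D(\theta^\uparrow)}+C\,\frac{\sigma^2}{n}\log(e/\delta),$$ where $D(\theta^\uparrow):=(\theta^\uparrow_{N,N}-\theta^\uparrow_{1,1})^2$.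
   Context: Bi-isotonic matrices: $\mathcal M:=\{\theta\in\mathbb{R}^{N\times N}:\ \theta_{j_1,j_2}\ge\theta_{i_1,i_2}\text{ whenever }j_1\ge i_1\text{ and }j_2\ge i_2\}$. The scalar $D(\theta):=(\theta_{N,N}-\theta_{1,1})^2$ is the square variation of a matrix $\theta$ (not to be confused with the incidence matrix $D$). The $N\times N$ grid has vertex set $[N]^2$ (identified with $[n]$), with an edge between two vertices iff their difference is $\pm(1,0)$ or $\pm(0,1)$. Its incidence matrix $D$ has one row per edge, with entries $1$ and $-1$ at the two endpoints and zeros elsewhere. *)

(* Defs.v *)
From HB Require Import structures.
From mathcomp Require Import all_boot all_order all_algebra.
From mathcomp Require Import all_classical all_reals all_analysis.

Set Implicit Arguments.
Unset Strict Implicit.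
Unset Printing Implicit Defensive.

Import Order.TTheory GRing.Theory Num.Theory.
Import numFieldNormedType.Exports.

Local Open Scope classical_set_scope.
Local Open Scope ring_scope.

(* The norm that the library puts on matrices is the sup norm, hence the
   entrywise l2 and l1 norms below. *)
Definition l2norm (R : realType) (m n : nat) (A : 'M[R]_(m, n)) : R :=
  Num.sqrt (\sum_(i < m) \sum_(j < n) A i j ^+ 2).

Definition l1norm (R : realType) (m n : nat) (A : 'M[R]_(m, n)) : R :=
  \sum_(i < m) \sum_(j < n) `|A i j|.

Definition bi_isotonic (R : realType) (N : nat) : set 'M[R]_N :=
  [set theta | forall i1 i2 j1 j2 : 'I_N,
     (i1 <= j1)%N -> (i2 <= j2)%N -> theta i1 i2 <= theta j1 j2].

Definition is_euclidean_proj (R : realType) (m n : nat)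
    (S : set 'M[R]_(m, n)) (x p : 'M[R]_(m, n)) : Prop :=
  S p /\ forall q, S q -> l2norm (p - x) <= l2norm (q - x).

(* (theta_{N,N} - theta_{1,1})^2; indices in 'I_N start at 0. *)
Definition square_variation (R : realType) (N : nat) (hN : (0 < N)%N)
    (theta : 'M[R]_N) : R :=
  let first : 'I_N := Ordinal hN in
  let last : 'I_N := rev_ord first in
  (theta last last - theta first first) ^+ 2.

Definition grid_adj (N : nat) (u v : 'I_N * 'I_N) : bool :=
  (u.1%:Z - v.1%:Z, u.2%:Z - v.2%:Z)
    \in [:: (1, 0); (-1, 0); (0, 1); (0, -1)].

(* Each undirected edge is listed once, as the pair of its endpoints in
   coordinatewise increasing order. *)
Definition grid_edges (N : nat) : {set ('I_N * 'I_N) * ('I_N * 'I_N)} :=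
  [set e | grid_adj e.1 e.2
           && ((e.1.1 <= e.2.1)%N && (e.1.2 <= e.2.2)%N)]%SET.

(* R^(N x N) is identified with R^(N * N) through mxvec, so columns are indexed
   by mxvec_index. The choice of which endpoint gets the entry 1 only changes
   signs of rows, to which l1norm (D *m x) is insensitive. *)
Definition grid_incidence (R : realType) (N : nat) :
    'M[R]_(#|grid_edges N|, N * N) :=
  \matrix_(e, k)
    let: (u, v) := enum_val e in
    (k == mxvec_index v.1 v.2)%:R - (k == mxvec_index u.1 u.2)%:R.

Definition grid_tv (R : realType) (N : nat) (theta : 'M[R]_N) : R :=
  l1norm (grid_incidence R N *m (mxvec theta)^T).

Definition tv_objective (R : realType) (N : nat) (lambda : R)
    (y theta : 'M[R]_N) : R :=
  (N ^ 2)%:R^-1 * l2norm (theta - y) ^+ 2 + lambda * grid_tv theta.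

Definition is_argmin (R : realType) (T : Type) (f : T -> R) (x : T) : Prop :=
  forall z, f x <= f z.

Definition mutually_independent (R : realType) (d : measure_display)
    (T : measurableType d) (P : probability T R) (I : finType)
    (X : I -> {RV P >-> R}) : Prop :=
  forall (J : {set I}) (A : I -> set R), (forall i, measurable (A i)) ->
    P (\bigcap_(i in [set` J]) (X i @^-1` A i))
    = (\prod_(i in J) P (X i @^-1` A i))%E.

(* The law N(0, sigma^2 Id) on R^I: i.i.d. N(0, sigma^2) coordinates.
   The second parameter of normal_prob is the standard deviation. *)
Definition isotropic_gaussian (R : realType) (d : measure_display)
    (T : measurableType d) (P : probability T R) (I : finType) (sigma : R)
    (X : I -> {RV P >-> R}) : Prop :=
  mutually_independent X /\
  forall i (A : set R), measurable A ->
    distribution P (X i) A = normal_prob 0 sigma A.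

(* Main.v *)
Require Import Defs.
From HB Require Import structures.
From mathcomp Require Import all_boot all_order all_algebra.
From mathcomp Require Import all_classical all_reals all_analysis.
From mathcomp Require Import measurable_realfun.
From mathcomp Require Import ring lra zify.
Import Order.TTheory GRing.Theory Num.Theory.
Import numFieldNormedType.Exports HBNNSimple.
Local Open Scope classical_set_scope.
Local Open Scope ring_scope.

(** The estimator is compared with the bi-isotonic projection, but only through the
    fact that the projection is bi-isotonic; the argument has a deterministic, a geometric
    and a probabilistic part.

    Deterministic part. The variational inequality of the convex problem
    ([penalized_argmin_variational]) gives an oracle inequality with leading constant 1
    ([penalized_oracle_inequality]): if the inner product of the noise with
    any [x] is at most [tau * grid_tv x] plus a term absorbed by the squared
    norm of [x], and [lambda] is at least [2 * tau / n], then the risk of the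
    estimator exceeds that of any matrix [bar] by at most [2 * lambda * grid_tv bar]
    plus the absorbed term. For a bi-isotonic matrix the total variation is at most
    [2 * N] times the square root of its square variation ([grid_tv_bi_isotonic]).

    Geometric part. The noise is controlled by the total variation by
    means of an explicit left inverse of the discrete gradient
    modulo constants. Every entry of [x] is rewritten as the mean of [x] plus a sum of
    edge differences weighted by a flow that carries a unit mass from that
    entry to the uniform distribution, spreading it over windows of doubling radius in turn ([sub_mean_flow]). The flow from a vertex has size
    of order [1 / r] at distance [r], so its squares, summed over all sources
    for a fixed edge, are of order [ln N]
    ([sum_sqr_flow_fst], [sum_sqr_flow_snd]). This elementary flow
    plays the role of the pseudo-inverse of the incidence matrix.

    Probabilistic part. After summation by parts ([mxdot_noise_le]) the noise enters
    through one linear form per edge, with variance of order [sigma ^+ 2 * ln n],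
    and through the sum of all its entries, with variance [sigma ^+ 2 * n]. Gaussian
    tails, with a union bound over the edges ([gaussian_linear_forms_tail]), bound the
    former by [tau] and the latter by a multiple of [sigma] times the square root of
    [n * ln (e / delta)], each with probability at least [1 - delta].

    Finally the event has to be measurable for its probability to be meaningful.
    It is, because the estimator is a 1-Lipschitz function of the
    noise ([penalized_argmin_nonexpansive], [measurable_nonexpansive_ball]). *)

Set Implicit Arguments.
Unset Strict Implicit.
Unset Printing Implicit Defensive.

(** * Gaussian linear forms *)

(** A law [nu] can be integrated against as soon as it is known on sets: by
    linearity and monotone convergence the hypothesis on indicators extends to
    all nonnegative [f]. It is used twice, with [g] a density (for the
    normal law) and with [g] a function of variables independent of [X]. *)
Lemma integral_weighted_comp (R : realType) (d : measure_display)
    (T : measurableType d) (P : {measure set T -> \bar R}) (X : T -> R)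
    (nu : {measure set R -> \bar R}) (g : T -> R) (c : R) :
  measurable_fun setT X -> measurable_fun setT g -> (forall x, 0 <= g x) -> 0 <= c ->
  (forall A : set R, measurable A ->
    (\int[P]_x (g x * \1_A (X x))%:E = c%:E * nu A)%E) ->
  forall f : R -> R, measurable_fun setT f -> (forall y, 0 <= f y) ->
  (\int[P]_x (g x * f (X x))%:E = c%:E * \int[nu]_x (f x)%:E)%E.
Proof.
move=> mX mg g0 c0 gA f mf f0.
have mE (h : T -> R) : measurable_fun setT h ->
    measurable_fun setT (fun x => (h x)%:E) by move=> ?; exact/measurable_EFinP.
have mE' (h : R -> R) : measurable_fun setT h ->
    measurable_fun setT (fun x => (h x)%:E) by move=> ?; exact/measurable_EFinP.
have mEf : measurable_fun setT (fun y : R => (f y)%:E) by exact/measurable_EFinP.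
pose phi := nnsfun_approx measurableT mEf.
have mphi n : measurable_fun setT (phi n : R -> R) by exact: measurable_funP.
have mphiX n : measurable_fun setT (fun x => phi n (X x)).
  exact: measurableT_comp (mphi n) mX.
have phi0 n y : 0 <= phi n y by exact: fun_ge0.
have cvgphi y : (phi n y)%:E @[n --> \oo] --> (f y)%:E.
  exact: (cvg_nnsfun_approx measurableT mEf (fun y _ => f0 y)).
have ndphi y m n : (m <= n)%N -> phi m y <= phi n y.
  by move=> mn; exact/lefP/nd_nnsfun_approx.
have simple n :
  (\int[P]_x (g x * phi n (X x))%:E = c%:E * \int[nu]_x (phi n x)%:E)%E.
  have mi r : measurable_fun setT (\1_(phi n @^-1` [set r]) : R -> R).
    exact: measurable_indic.
  have miX r : measurable_fun setT (fun x => \1_(phi n @^-1` [set r]) (X x) : R).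
    exact: measurableT_comp (mi r) mX.
  have r0 r y : 0 <= r * \1_(phi n @^-1` [set r]) y.
    by have := nnfun_muleindic_ge0 (phi n) r y; rewrite lee_fin.
  transitivity (\sum_(r \in range (phi n))
      (r%:E * (c%:E * nu (phi n @^-1` [set r]))))%E.
    under eq_integral do rewrite fimfunE mulr_fsumr -fsumEFin//.
    rewrite ge0_integral_fsum//=; last 2 first.
    - move=> r; apply: mE; apply: measurable_funM => //.
      exact: measurable_funM.
    - by move=> r x _; rewrite lee_fin mulr_ge0.
    apply: eq_fsbigr => r /[!inE] -[z _ zr].
    have rge0 : 0 <= r by rewrite -zr.
    under eq_integral do rewrite mulrCA EFinM.
    rewrite ge0_integralZl//=; first by rewrite gA.
    - by apply: mE; apply: measurable_funM.
    - by move=> x _; rewrite lee_fin mulr_ge0.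
  under [in RHS]eq_integral do rewrite fimfunE -fsumEFin//.
  rewrite ge0_integral_fsum//=; last 2 first.
  - by move=> r; apply: mE'; apply: measurable_funM.
  - by move=> r x _; rewrite lee_fin.
  rewrite ge0_mule_fsumr; last first.
    by move=> r; apply: integral_ge0 => x _; rewrite lee_fin.
  apply: eq_fsbigr => r /[!inE] -[z _ zr].
  have rge0 : 0 <= r by rewrite -zr.
  under [in RHS]eq_integral do rewrite EFinM.
  rewrite ge0_integralZl//=; last by apply: mE'.
  rewrite muleCA; congr (_ * (_ * _))%E.
  by rewrite integral_indic ?setIT.
have lhs : (\int[P]_x (g x * phi n (X x))%:E @[n --> \oo] --> \int[P]_x (g x * f (X x))%:E)%E.
  under [X in _ --> X]eq_integral => x _.
    have <- : limn (fun n => (g x * phi n (X x))%:E) = (g x * f (X x))%:E.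
      apply/cvg_lim => //; under eq_fun do rewrite EFinM.
      by rewrite EFinM; apply: cvgeZl.
    over.
  apply: cvg_monotone_convergence => //.
  - by move=> n; apply: mE; apply: measurable_funM.
  - by move=> n x _; rewrite lee_fin mulr_ge0.
  - by move=> x _ m n mn; rewrite lee_fin ler_wpM2l// ndphi.
have rhs : (\int[nu]_x (phi n x)%:E @[n --> \oo] --> \int[nu]_x (f x)%:E)%E.
  under [X in _ --> X]eq_integral => x _.
    have <- : limn (fun n => (phi n x)%:E) = (f x)%:E by apply/cvg_lim.
    over.
  apply: cvg_monotone_convergence => //.
  - by move=> n; apply/measurable_EFinP.
  - by move=> n x _; rewrite lee_fin.
  - by move=> x _ m n mn; rewrite lee_fin ndphi.
have := cvg_lim (@ereal_hausdorff R) lhs => <-.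
apply/cvg_lim => //; under eq_fun do rewrite simple.
by apply: cvgeZl.
Qed.

(** Independence is the product rule for events, that is, the claim for
    indicators; the indicators are replaced by the general factors one
    index at a time. *)
Lemma integral_prod_independent (R : realType) (d : measure_display)
    (T : measurableType d) (P : probability T R) (I : finType)
    (X : I -> {RV P >-> R}) (f : I -> R -> R) (m : I -> R) :
  mutually_independent X ->
  (forall i, measurable_fun setT (f i)) -> (forall i y, 0 <= f i y) ->
  (forall i, \int[P]_x (f i (X i x))%:E = (m i)%:E)%E ->
  (\int[P]_x (\prod_i f i (X i x))%:E = (\prod_i m i)%:E)%E.
Proof.
move=> indX.
have mX i : measurable_fun setT (X i) by exact: measurable_funP.
have mpre i (A : set R) : measurable A -> measurable (X i @^-1` A).
  by move=> mA; rewrite -[X in measurable X]setTI; exact: mX.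
(* [s] lists the indices whose factor is allowed not to be an indicator. *)
suff main (s : seq I) : forall (f : I -> R -> R) (m : I -> R),
    (forall i, i \notin s -> exists2 A : set R, measurable A & f i = \1_A) ->
    (forall i, measurable_fun setT (f i)) -> (forall i y, 0 <= f i y) ->
    (forall i, \int[P]_x (f i (X i x))%:E = (m i)%:E)%E ->
    (\int[P]_x (\prod_i f i (X i x))%:E = (\prod_i m i)%:E)%E.
  by apply: (main (enum I)) => i; rewrite mem_enum.
elim: s => [|a s IHs] {}f {}m fs mf f0 fm.
  have /choice[A fA] : forall i, exists A : set R, measurable A /\ f i = \1_A.
    by move=> i; have [//|A mA fE] := fs i; exists A.
  have mE i : P (X i @^-1` A i) = (m i)%:E.
    rewrite -fm (fA i).2.
    rewrite -[RHS]/(\int[P]_x (\1_(X i @^-1` A i) x)%:E)%E.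
    by rewrite integral_indic ?setIT//; apply: mpre; exact: (fA i).1.
  have := indX [set: I]%SET A (fun i => (fA i).1).
  rewrite (eq_bigr (fun i => (m i)%:E)); last by move=> i _; exact: mE.
  rewrite (eq_bigl xpredT); last by move=> i; rewrite inE.
  rewrite prodEFin => <-; rewrite -[X in P X]setIT -integral_indic//; last first.
    apply: fin_bigcap_measurable => // i _; apply: mpre; exact: (fA i).1.
  apply: eq_integral => x _; congr (_%:E).
  under eq_bigr do rewrite (fA _).2 indicE.
  rewrite indicE -natr_prod; congr (_%:R).
  have [allx|/existsNP[i iA]] := pselect (forall i, A i (X i x)).
    rewrite mem_set ?big1// => [i _|i _]; [by rewrite mem_set|exact: allx].
  rewrite memNset; last by move=> h; apply/iA/h; rewrite /= inE.
  by rewrite (bigD1 i)//= memNset.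
pose g x := \prod_(i | i != a) f i (X i x).
have g0 x : 0 <= g x by apply: prodr_ge0 => i _; exact: f0.
have mg : measurable_fun setT g.
  rewrite /g; under eq_fun do rewrite -big_filter.
  apply: measurable_prod => i _; exact: measurableT_comp (mf i) (mX i).
have m0 i : 0 <= m i.
  by rewrite -lee_fin -fm; apply: integral_ge0 => x _; rewrite lee_fin.
under eq_integral do rewrite (bigD1 a)//= mulrC.
rewrite (bigD1 a)//= mulrC EFinM -fm.
rewrite (@integral_weighted_comp _ _ _ P (X a) (distribution P (X a)) g
  (\prod_(i | i != a) m i))//.
- congr (_ * _)%E; rewrite ge0_integral_distribution//.
    exact/measurable_EFinP.
  by move=> y; rewrite lee_fin.
- exact: prodr_ge0.
- move=> A mA.
  pose f' i := if i == a then \1_A else f i.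
  pose m' i := if i == a then fine (P (X a @^-1` A)) else m i.
  have := IHs f' m'; rewrite (bigD1 a)//= /m' eqxx.
  under eq_bigr => i /negPf -> do [].
  rewrite mulrC EFinM fineK ?fin_num_measure//; last exact: mpre.
  move=> <-.
  + apply: eq_integral => x _; rewrite (bigD1 a)//= /f' eqxx mulrC; congr (_ * _)%:E.
    by apply: eq_bigr => i /negPf ->.
  + move=> i i_s; rewrite /f'; case: eqP => [_|/eqP ia]; first by exists A.
    by apply: fs; rewrite inE negb_or ia.
  + by move=> i; rewrite /f'; case: ifP => // _; exact: measurable_indic.
  + by move=> i y; rewrite /f'; case: ifP.
  + move=> i; rewrite /f'; case: eqP => [->|_]; last exact: fm.
    rewrite -[LHS]/(\int[P]_x (\1_(X a @^-1` A) x)%:E)%E.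
    by rewrite integral_indic ?setIT ?fineK ?fin_num_measure//; apply: mpre.
Qed.

(** Completing the square turns [expR (s * y)] times the centred density into a
    constant multiple of the density with mean [s * sigma ^+ 2]. *)
Lemma expectation_expR_normal (R : realType) (d : measure_display)
    (T : measurableType d) (P : probability T R) (X : {RV P >-> R})
    (sigma s : R) :
  0 < sigma ->
  (forall A : set R, measurable A ->
    distribution P X A = normal_prob 0 sigma A) ->
  (\int[P]_x (expR (s * X x))%:E = (expR (s ^+ 2 * sigma ^+ 2 / 2))%:E)%E.
Proof.
move=> sigma0 lawX.
have mexp : measurable_fun setT (fun y : R => expR (s * y)).
  by apply: measurableT_comp => //; exact: mulrl_measurable.
rewrite -[LHS](@ge0_integral_distribution _ _ _ _ _ P X
    (fun y => (expR (s * y))%:E)); last 2 first.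
- exact/measurable_EFinP.
- by move=> y; rewrite lee_fin expR_ge0.
have := @integral_weighted_comp _ _ _ (@lebesgue_measure R) idfun
   (distribution P X) (normal_pdf 0 sigma) 1.
move=> /(_ (@measurable_id _ _ _) (measurable_normal_pdf _ _) (normal_pdf_ge0 _ _) ler01 _ _ mexp
          (fun y => expR_ge0 _)).
rewrite mul1e => <-; last first.
  move=> A mA; rewrite mul1e [RHS]lawX// /normal_prob [RHS]integral_mkcond.
  apply: eq_integral => y _; rewrite patchE indicE /=.
  by case: (y \in A); rewrite ?mulr1 ?mulr0.
transitivity (\int[lebesgue_measure]_y ((expR (s ^+ 2 * sigma ^+ 2 / 2))%:E *
    (normal_pdf (s * sigma ^+ 2) sigma y)%:E))%E.
  apply: eq_integral => y _ /=; rewrite -EFinM; congr (_%:E).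
  rewrite /normal_pdf gt_eqF//= -[LHS]mulrA [RHS]mulrCA /normal_fun -!expRD.
  congr (_ * expR _); field; by rewrite gt_eqF.
rewrite ge0_integralZl ?lee_fin ?expR_ge0//=.
- by rewrite integral_normal_pdf mule1.
- by apply/measurable_EFinP; exact: measurable_normal_pdf.
- by move=> y _; rewrite lee_fin normal_pdf_ge0.
Qed.

(** Chernoff bound, with the moment generating function computed by independence. *)
Lemma gaussian_linear_form_upper_tail (R : realType) (d : measure_display)
    (T : measurableType d) (P : probability T R) (I : finType)
    (X : I -> {RV P >-> R}) (sigma : R) (a : I -> R) (v t : R) :
  0 < sigma -> isotropic_gaussian sigma X ->
  0 < v -> \sum_i a i ^+ 2 <= v -> 0 < t ->
  (P [set w | t <= \sum_i a i * X i w]%R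
    <= (expR (- (t ^+ 2 / (2 * sigma ^+ 2 * v))))%:E)%E.
Proof.
move=> sigma0 [indX lawX] v0 av t0.
have s2 : 0 < sigma ^+ 2 by rewrite exprn_gt0.
have mS : measurable_fun setT (fun w => \sum_i a i * X i w).
  apply: measurable_sum => i; apply: measurable_funM => //.
pose S : {RV P >-> R} := HB.pack (fun w => \sum_i a i * X i w)
  (isMeasurableFun.Build _ _ _ _ _ mS).
(* The minimiser over [r] of the exponent [r ^+ 2 * sigma ^+ 2 * v / 2 - r * t]. *)
pose r := t / (sigma ^+ 2 * v).
have r0 : 0 < r by rewrite divr_gt0// mulr_gt0.
apply: le_trans (chernoff S t r0) _.
have -> : ('M_P S r = (expR (r ^+ 2 * sigma ^+ 2 / 2 * \sum_i a i ^+ 2))%:E)%E.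
  rewrite /mmt_gen_fun unlock.
  transitivity (\int[P]_w (\prod_i expR (r * a i * X i w))%:E)%E.
    apply: eq_integral => w _; rewrite /= mulr_suml expR_sum; congr (_%:E).
    by apply: eq_bigr => i _; congr expR; rewrite mulrC mulrA.
  rewrite (@integral_prod_independent _ _ _ _ _ X (fun i y => expR (r * a i * y))
     (fun i => expR ((r * a i) ^+ 2 * sigma ^+ 2 / 2)) indX).
  - rewrite -expR_sum mulr_sumr; congr (expR _)%:E.
    by apply: eq_bigr => i _; field.
  - move=> i; apply: measurableT_comp => //; exact: mulrl_measurable.
  - by move=> i y; exact: expR_ge0.
  - by move=> i; apply: expectation_expR_normal => //; exact: lawX.
rewrite -EFinM lee_fin -expRD ler_expR.
have -> : - (t ^+ 2 / (2 * sigma ^+ 2 * v)) =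
    r ^+ 2 * sigma ^+ 2 / 2 * v - r * t.
  by rewrite /r; field; rewrite !gt_eqF.
rewrite lerD2r ler_wpM2l//.
by rewrite divr_ge0// mulr_ge0// ?exprn_ge0// ltW.
Qed.

Lemma gaussian_linear_form_tail (R : realType) (d : measure_display)
    (T : measurableType d) (P : probability T R) (I : finType)
    (X : I -> {RV P >-> R}) (sigma : R) (a : I -> R) (v t : R) :
  0 < sigma -> isotropic_gaussian sigma X ->
  0 < v -> \sum_i a i ^+ 2 <= v -> 0 < t ->
  measurable [set w | t <= `|\sum_i a i * X i w|] /\
  (P [set w | t <= `|\sum_i a i * X i w|]%R
    <= (2 * expR (- (t ^+ 2 / (2 * sigma ^+ 2 * v))))%:E)%E.
Proof.
move=> sigma0 gX v0 av t0.
have meas b : measurable [set w | t <= \sum_i b i * X i w].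
  rewrite -[X in measurable X]setTI; apply: measurable_fun_le => //.
  apply: measurable_sum => i; apply: measurable_funM => //.
have -> : [set w | t <= `|\sum_i a i * X i w|] =
    [set w | t <= \sum_i a i * X i w] `|` [set w | t <= \sum_i (- a i) * X i w].
  apply/seteqP; split => w /=; under [X in _ \/ t <= X]eq_bigr do rewrite mulNr;
    by rewrite sumrN ler_normr => /orP.
split; first exact: measurableU.
apply: le_trans (measureU2 _ _ _) _ => //.
rewrite mulr2n mulrDl mul1r EFinD; apply: leeD.
- exact: gaussian_linear_form_upper_tail.
- apply: gaussian_linear_form_upper_tail => //.
  by under eq_bigr do rewrite sqrrN.
Qed.

Lemma gaussian_linear_forms_tail (R : realType) (d : measure_display)
    (T : measurableType d) (P : probability T R) (I K : finType)
    (X : I -> {RV P >-> R}) (sigma : R) (a : K -> I -> R) (v t : R) :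
  0 < sigma -> isotropic_gaussian sigma X ->
  0 < v -> (forall k, \sum_i a k i ^+ 2 <= v) -> 0 < t ->
  measurable [set w | exists k, t <= `|\sum_i a k i * X i w|] /\
  (P [set w | exists k, t <= `|\sum_i a k i * X i w|]%R
    <= (#|K|%:R * (2 * expR (- (t ^+ 2 / (2 * sigma ^+ 2 * v)))))%:E)%E.
Proof.
move=> sigma0 gX v0 av t0.
have tail k := gaussian_linear_form_tail sigma0 gX v0 (av k) t0.
have -> : [set w | exists k, t <= `|\sum_i a k i * X i w|] =
    \big[setU/set0]_(k <- enum K) [set w | t <= `|\sum_i a k i * X i w|].
  rewrite -bigcup_seq; apply/seteqP; split => w /=.
    by move=> [k kw]; exists k => //=; rewrite mem_enum.
  by move=> [k _ kw]; exists k.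
rewrite cardE; elim: (enum K) => [|k s [mIH IH]].
  by rewrite big_nil measure0 mul0r; split.
rewrite big_cons; split; first by apply: measurableU => //; exact: (tail k).1.
apply: le_trans (measureU2 _ _ _) _ => //; first exact: (tail k).1.
rewrite /= -addn1 natrD addrC mulrDl mul1r EFinD; apply: leeD => //.
exact: (tail k).2.
Qed.

(** * Measurability of events open in the noise *)

(** The preimage of an open subset of a Euclidean space under a random vector,
    phrased without mentioning the open subset: it is the union of the
    preimages of the countably many boxes with rational centre and
    radius that it contains. *)
Lemma measurable_open_in_rvs (R : realType) (d : measure_display)
    (T : measurableType d) (P : probability T R) (I : finType)
    (X : I -> {RV P >-> R}) (A : set T) :
  (forall w, A w -> exists2 eta : R, 0 < eta &
    forall w', \sum_i (X i w' - X i w) ^+ 2 < eta -> A w') ->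
  measurable A.
Proof.
move=> openA.
pose box (q : {ffun I -> rat} * rat) : set T :=
  \bigcap_(i in [set` [set: I]%SET])
    [set w | `|X i w - ratr (q.1 i)| < ratr q.2].
pose F q : set T := if `[< box q `<=` A >] then box q else set0.
have -> : A = \bigcup_q F q.
  apply/seteqP; split => [w Aw|w [q _]]; last first.
    by rewrite /F; case: asboolP => // qA /qA.
  have [eta eta0 etaA] := openA _ Aw.
  (* A box of radius [s] with [s ^+ 2 <= c] has squared diameter at most
     [#|I| * (4 * c)], which is less than [eta]. *)
  pose c : R := eta / (4 * #|I|.+1%:R).
  have c0 : 0 < c by rewrite divr_gt0// mulr_gt0.
  have min0 : 0 < Num.min 1 c by rewrite lt_min ltr01.
  have [s] := rat_in_itvoo min0.
  rewrite in_itv/= lt_min => /andP[s0 /andP[s1 sc]].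
  have /choice[q qw] : forall i, exists q : rat, `|X i w - ratr q| < ratr s.
    move=> i; have lt_s : X i w - ratr s < X i w + ratr s.
      by rewrite ltrD2l gtrN.
    have [q] := rat_in_itvoo lt_s.
    rewrite in_itv/= => /andP[q1 q2]; exists q.
    by rewrite distrC ltr_distl q1 q2.
  exists ([ffun i => q i], s) => //.
  have wbox : box ([ffun i => q i], s) w by move=> i _ /=; rewrite ffunE.
  rewrite /F; case: asboolP => // -[] w' w'box; apply: etaA.
  have le1 i : (X i w' - X i w) ^+ 2 <= 4 * c.
    have := w'box i; rewrite /= inE ffunE => /(_ isT) w's.
    have ws := qw i.
    have : `|X i w' - X i w| <= 2 * ratr s.
      rewrite (_ : X i w' - X i w =
        (X i w' - ratr (q i)) - (X i w - ratr (q i))); last by ring.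
      by apply: le_trans (ler_normB _ _) _; lra.
    rewrite -real_normK ?num_real// => h.
    apply: (@le_trans _ _ ((2 * ratr s) ^+ 2)); first by rewrite ler_sqr ?nnegrE//; lra.
    rewrite exprMn -natrX; nra.
  apply: (@le_lt_trans _ _ (\sum_(i : I) 4 * c)); first exact: ler_sum.
  rewrite sumr_const -[X in X < _]mulr_natr /c.
  rewrite (_ : _ * _ = eta * (#|I|%:R / #|I|.+1%:R)); last first.
    by field; rewrite gt_eqF.
  rewrite gtr_pMr// ltr_pdivrMr// mul1r ltr_nat//.
apply: countable_bigcupT_measurable; first exact: countableP.
move=> q; rewrite /F; case: asboolP => // _.
apply: fin_bigcap_measurable => // i _.
have mabs : measurable_fun setT (fun w => `|X i w - ratr (q.1 i)|).
  by apply: measurableT_comp => //; exact: measurable_funB.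
rewrite [X in measurable X](_ : _ =
    ~` [set w | ratr q.2 <= `|X i w - ratr (q.1 i)|]); last first.
  by apply/seteqP; split => w /=; rewrite ltNge => /negP.
apply: measurableC; rewrite -[X in measurable X]setTI.
exact: measurable_fun_le.
Qed.

(** * Penalized least squares *)

Definition mxdot (R : realType) (m n : nat) (A B : 'M[R]_(m, n)) : R :=
  \sum_i \sum_j A i j * B i j.

Lemma l2norm_sqr (R : realType) (m n : nat) (A : 'M[R]_(m, n)) :
  l2norm A ^+ 2 = mxdot A A.
Proof.
rewrite sqr_sqrtr //.
by apply: sumr_ge0 => i _; apply: sumr_ge0 => j _; exact: sqr_ge0.
Qed.

Lemma mxdot_ge0 (R : realType) (m n : nat) (A : 'M[R]_(m, n)) : 0 <= mxdot A A.
Proof. by rewrite -l2norm_sqr sqr_ge0. Qed.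

Lemma mxdotC (R : realType) (m n : nat) (A B : 'M[R]_(m, n)) :
  mxdot A B = mxdot B A.
Proof. by apply: eq_bigr => i _; apply: eq_bigr => j _; rewrite mulrC. Qed.

Lemma mxdotDl (R : realType) (m n : nat) (A B C : 'M[R]_(m, n)) :
  mxdot (A + B) C = mxdot A C + mxdot B C.
Proof.
rewrite /mxdot -big_split; apply: eq_bigr => i _ /=.
by rewrite -big_split; apply: eq_bigr => j _; rewrite !mxE mulrDl.
Qed.

Lemma mxdotZl (R : realType) (m n : nat) (s : R) (A C : 'M[R]_(m, n)) :
  mxdot (s *: A) C = s * mxdot A C.
Proof.
rewrite /mxdot mulr_sumr; apply: eq_bigr => i _ /=.
by rewrite mulr_sumr; apply: eq_bigr => j _; rewrite !mxE mulrA.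
Qed.

Lemma mxdotNl (R : realType) (m n : nat) (A C : 'M[R]_(m, n)) :
  mxdot (- A) C = - mxdot A C.
Proof. by rewrite -scaleN1r mxdotZl mulN1r. Qed.

Lemma mxdotDr (R : realType) (m n : nat) (A B C : 'M[R]_(m, n)) :
  mxdot C (A + B) = mxdot C A + mxdot C B.
Proof. by rewrite ![mxdot C _]mxdotC mxdotDl. Qed.

Lemma mxdotZr (R : realType) (m n : nat) (s : R) (A C : 'M[R]_(m, n)) :
  mxdot C (s *: A) = s * mxdot C A.
Proof. by rewrite ![mxdot C _]mxdotC mxdotZl. Qed.

Lemma mxdotNr (R : realType) (m n : nat) (A C : 'M[R]_(m, n)) :
  mxdot C (- A) = - mxdot C A.
Proof. by rewrite ![mxdot C _]mxdotC mxdotNl. Qed.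

Definition mxdotE := (mxdotDl, mxdotDr, mxdotNl, mxdotNr, mxdotZl, mxdotZr).

Definition segment_convex (R : realType) (N : nat) (F : 'M[R]_N -> R) : Prop :=
  forall u v s, 0 <= s <= 1 -> F (u + s *: (v - u)) <= F u + s * (F v - F u).

Lemma segment_convexZ (R : realType) (N : nat) (lambda : R) (F : 'M[R]_N -> R) :
  0 <= lambda -> segment_convex F -> segment_convex (fun u => lambda * F u).
Proof.
move=> lambda0 Fconvex u v s s01; rewrite -mulrBr mulrCA -mulrDr.
by apply: ler_wpM2l => //; exact: Fconvex.
Qed.

(** First-order optimality without derivatives of [F]: the objective cannot
    decrease along the segment from the minimiser [x] to [z], along which its
    increment is at most [s * B + s ^+ 2 * Q] with [B] the right-hand side below. *)
Lemma penalized_argmin_variational (R : realType) (N : nat) (k : R)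
    (F : 'M[R]_N -> R) (y x : 'M[R]_N) :
  0 <= k -> segment_convex F ->
  is_argmin (fun u => k * l2norm (u - y) ^+ 2 + F u) x ->
  forall z, 0 <= 2 * k * mxdot (x - y) (z - x) + (F z - F x).
Proof.
move=> k0 Fconvex xmin z.
set B := _ + _; rewrite leNgt; apply/negP => B0.
pose Q := k * mxdot (z - x) (z - x).
have Q0 : 0 <= Q by rewrite mulr_ge0 ?mxdot_ge0.
(* If [B < 0], this step makes [s * B + s ^+ 2 * Q] equal to [s ^+ 2 * B],
   hence negative. *)
pose s := - B / (Q - B).
have QB : 0 < Q - B by lra.
have s0 : 0 < s by rewrite divr_gt0 ?oppr_gt0.
have s1 : s <= 1 by rewrite ler_pdivrMr// mul1r; lra.
have sQB : s * (Q - B) = - B by rewrite /s divfK// gt_eqF.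
have := xmin (x + s *: (z - x)).
have := Fconvex x z s; rewrite (ltW s0) s1 => /(_ isT).
rewrite !l2norm_sqr -addrA [s *: _ + _]addrC addrA.
rewrite (mxdotDl (x - y)) !(mxdotDr (x - y)) mxdotZr !(mxdotZl s) mxdotZr.
rewrite [mxdot (z - x) (x - y)]mxdotC.
move=> h1 h2.
have : 0 <= s * (B + s * Q) by rewrite /B /Q; lra.
rewrite pmulr_rge0//.
rewrite (_ : B + s * Q = s * B); last by lra.
by rewrite pmulr_rge0// leNgt B0.
Qed.

(** Adding the variational inequalities of the two minimisers, each tested at the
    other one, cancels the penalty and leaves
    [mxdot p p <= mxdot q p], with [p = x' - x] and [q = y' - y];
    the positivity of [mxdot (q - p) (q - p)] then gives the claim. *)
Lemma penalized_argmin_nonexpansive (R : realType) (N : nat) (k : R)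
    (F : 'M[R]_N -> R) (y y' x x' : 'M[R]_N) :
  0 < k -> segment_convex F ->
  is_argmin (fun u => k * l2norm (u - y) ^+ 2 + F u) x ->
  is_argmin (fun u => k * l2norm (u - y') ^+ 2 + F u) x' ->
  mxdot (x' - x) (x' - x) <= mxdot (y' - y) (y' - y).
Proof.
move=> k0 Fconvex xmin x'min.
have := penalized_argmin_variational (ltW k0) Fconvex xmin x'.
have := penalized_argmin_variational (ltW k0) Fconvex x'min x.
have := mxdot_ge0 ((y' - y) - (x' - x)).
have -> : x' - y' = (x - y) + ((x' - x) - (y' - y)).
  by apply/matrixP => i j; rewrite !mxE; ring.
rewrite -[x - x']opprB.
move: (x' - x) (y' - y) (x - y) => p q r.
rewrite !mxdotE [mxdot q p]mxdotC => h1 h2 h3.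
have : 0 <= (2 * k) * (mxdot p q - mxdot p p) by lra.
by rewrite pmulr_rge0 ?mulr_gt0//; lra.
Qed.

(** The leading constant 1 in front of the approximation error comes from the
    negative quadratic term [- k * mxdot (hat - bar) (hat - bar)] that the
    variational inequality leaves behind: it absorbs the part of the noise
    that the penalty does not control, here accounted for by [E]. *)
Lemma penalized_oracle_inequality (R : realType) (N : nat) (k lambda tau E : R)
    (tv : 'M[R]_N -> R) (star eps hat bar : 'M[R]_N) :
  0 <= k -> 0 <= lambda -> 2 * k * tau <= lambda ->
  (forall u, 0 <= tv u) ->
  (forall u v, tv (u - v) <= tv u + tv v) ->
  segment_convex tv ->
  (forall x, 2 * mxdot eps x <= mxdot x x + E + 2 * tau * tv x) ->
  is_argmin (fun u => k * l2norm (u - (star + eps)) ^+ 2 + lambda * tv u) hat ->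
  k * l2norm (hat - star) ^+ 2 <=
    k * l2norm (bar - star) ^+ 2 + 2 * lambda * tv bar + k * E.
Proof.
move=> k0 lam0 taulam tv0 tvB tvconvex noise hatmin.
have Fconvex := segment_convexZ lam0 tvconvex.
have := penalized_argmin_variational k0 Fconvex hatmin bar.
have := noise (hat - bar).
move: (tvB hat bar) (tv0 (hat - bar)); rewrite !l2norm_sqr.
have -> : bar - hat = - (hat - bar) by rewrite opprB.
have -> : hat - (star + eps) = (bar - star) + (hat - bar) - eps.
  by apply/matrixP => i j; rewrite !mxE; ring.
have -> : hat - star = (bar - star) + (hat - bar).
  by apply/matrixP => i j; rewrite !mxE; ring.
move: (hat - bar) (bar - star) => p r.
rewrite !mxdotE [mxdot p r]mxdotC => tvp tvp0 /(ler_wpM2l k0) noisep vi.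
have h1 := ler_wpM2r tvp0 taulam.
have h2 := ler_wpM2l lam0 tvp.
lra.
Qed.

(** * Total variation on the grid *)

(** The successor is clamped at the last index, so that discrete gradients are
    defined at every vertex and vanish where the grid has no edge. *)
Definition ord_next (N : nat) (a : 'I_N) : 'I_N := insubd a a.+1.

Lemma val_ord_next (N : nat) (a : 'I_N) :
  ord_next a = (if (a.+1 < N)%N then a.+1 else a) :> nat.
Proof. by rewrite /ord_next val_insubd. Qed.

Lemma grid_edge_next (N : nat) (u v : 'I_N * 'I_N) : v != u ->
  ((u, v) \in grid_edges N) =
  (v == (ord_next u.1, u.2)) || (v == (u.1, ord_next u.2)).
Proof.
case: u v => [a b] [c d]; rewrite inE /grid_adj /= !inE !xpair_eqE -!val_eqE /=.
rewrite !val_ord_next; have := ltn_ord c; have := ltn_ord d.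
by case: ifP; case: ifP; lia.
Qed.

Lemma sum_grid_edges_from (R : realType) (N : nat) (u : 'I_N * 'I_N)
    (G : 'I_N * 'I_N -> R) : G u = 0 ->
  \sum_(v | (u, v) \in grid_edges N) G v =
  G (ord_next u.1, u.2) + G (u.1, ord_next u.2).
Proof.
move=> Gu0.
have point v0 : G v0 = \sum_v (v == v0)%:R * G v.
  rewrite (bigD1 v0)//= eqxx mul1r big1 ?addr0// => v /negPf ->.
  by rewrite mul0r.
rewrite big_mkcond (point (_, _)) [X in _ + X](point (_, _)) -big_split.
apply: eq_bigr => v _ /=; have [->|vu] := eqVneq v u.
  by rewrite Gu0 !mulr0 addr0 if_same.
rewrite grid_edge_next//.
have [v1|_] := eqVneq v (ord_next u.1, u.2); last first.
  by case: eqVneq => _ /=; rewrite ?mul1r ?mul0r ?add0r ?addr0.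
rewrite /= mul1r; case: eqVneq => [v2|_]; last by rewrite mul0r addr0.
case/eqP: vu; rewrite v1; have [-> _] := etrans (esym v1) v2.
by rewrite -surjective_pairing.
Qed.

Lemma grid_tvE (R : realType) (N : nat) (theta : 'M[R]_N) :
  grid_tv theta = \sum_a \sum_b
    (`|theta (ord_next a) b - theta a b| + `|theta a (ord_next b) - theta a b|).
Proof.
rewrite /grid_tv /l1norm.
pose G (u v : 'I_N * 'I_N) := `|theta v.1 v.2 - theta u.1 u.2|.
transitivity (\sum_(e in grid_edges N) G e.1 e.2).
  rewrite [RHS]big_enum_val; apply: eq_bigr => e _.
  rewrite big_ord1 mxE; congr (`| _ |).
  case ev: (enum_val e) => [u v].
  under eq_bigr do rewrite !mxE ev mulrBl.
  rewrite sumrB; congr (_ - _).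
    rewrite (bigD1 (mxvec_index v.1 v.2))//= eqxx mul1r mxvecE big1 ?addr0//.
    by move=> k /negPf ->; rewrite mul0r.
  rewrite (bigD1 (mxvec_index u.1 u.2))//= eqxx mul1r mxvecE big1 ?addr0//.
  by move=> k /negPf ->; rewrite mul0r.
transitivity (\sum_u \sum_(v | (u, v) \in grid_edges N) G u v).
  by rewrite pair_big_dep/=; apply: eq_bigl => -[].
rewrite pair_bigA/=; apply: eq_bigr => u _.
by rewrite sum_grid_edges_from// /G subrr normr0.
Qed.

Lemma grid_tv_ge0 (R : realType) (N : nat) (theta : 'M[R]_N) : 0 <= grid_tv theta.
Proof. by rewrite /grid_tv; do 2 (apply: sumr_ge0 => ? _). Qed.

Lemma grid_tvD (R : realType) (N : nat) (u v : 'M[R]_N) :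
  grid_tv (u + v) <= grid_tv u + grid_tv v.
Proof.
rewrite /grid_tv linearD linearD/= mulmxDr /l1norm -big_split.
apply: ler_sum => i _ /=; rewrite -big_split; apply: ler_sum => j _ /=.
by rewrite mxE ler_normD.
Qed.

Lemma grid_tvZ (R : realType) (N : nat) (s : R) (u : 'M[R]_N) :
  grid_tv (s *: u) = `|s| * grid_tv u.
Proof.
rewrite /grid_tv linearZ linearZ/= -scalemxAr /l1norm mulr_sumr.
apply: eq_bigr => i _ /=; rewrite mulr_sumr; apply: eq_bigr => j _ /=.
by rewrite mxE normrM.
Qed.

Lemma grid_tvB (R : realType) (N : nat) (u v : 'M[R]_N) :
  grid_tv (u - v) <= grid_tv u + grid_tv v.
Proof.
apply: le_trans (grid_tvD _ _) _.
by rewrite -scaleN1r grid_tvZ normrN1 mul1r.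
Qed.

Lemma grid_tv_convex (R : realType) (N : nat) : segment_convex (@grid_tv R N).
Proof.
move=> u v s /andP[s0 s1].
have -> : u + s *: (v - u) = (1 - s) *: u + s *: v.
  by apply/matrixP => i j; rewrite !mxE; ring.
apply: le_trans (grid_tvD _ _) _.
by rewrite !grid_tvZ !ger0_norm ?subr_ge0//; lra.
Qed.

Lemma sum_ord_next (R : realType) (m : nat) (f : 'I_m.+1 -> R) (b : 'I_m.+1) :
  \sum_(t < m.+1 | (b <= t)%N) (f (ord_next t) - f t) = f ord_max - f b.
Proof.
pose g n := f (inord (minn n m)).
transitivity (\sum_(t < m.+1 | (b <= t)%N) (g t.+1 - g t)).
  apply: eq_bigr => t _; congr (f _ - f _); apply: val_inj => /=.
    by rewrite inordK ?val_ord_next; have := ltn_ord t; [case: ifP|]; lia.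
  by rewrite inordK; have := ltn_ord t; lia.
rewrite -(big_geq_mkord _ _ xpredT (fun t => g t.+1 - g t)) telescope_sumr; last first.
  by rewrite ltnW.
by congr (f _ - f _); apply: val_inj; rewrite /= inordK; have := ltn_ord b; lia.
Qed.

(** In each row and in each column a bi-isotonic matrix is monotone, so that
    the differences telescope to at most the difference of the two extreme
    entries of the matrix; there are [2 * N] such lines. *)
Lemma grid_tv_bi_isotonic (R : realType) (N : nat) (hN : (0 < N)%N)
    (theta : 'M[R]_N) : bi_isotonic theta ->
  grid_tv theta <= 2 * N%:R * Num.sqrt (square_variation hN theta).
Proof.
case: N hN theta => // m hN theta iso.
have le_next (t : 'I_m.+1) : (t <= ord_next t)%N.
  by rewrite val_ord_next; case: ifP.
rewrite /square_variation sqrtr_sqr.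
set D := _ - _.
have D0 : 0 <= D by rewrite subr_ge0 iso.
rewrite ger0_norm// grid_tvE.
under eq_bigr do rewrite big_split.
rewrite big_split /= exchange_big /= -mulrA mulrDl mul1r.
have last_max : rev_ord (Ordinal hN) = ord_max :> 'I_m.+1.
  by apply: val_inj; rewrite /= subn1.
have all_ge0 f : \sum_(t : 'I_m.+1) f t = \sum_(t : 'I_m.+1 | (Ordinal hN <= t)%N) f t :> R.
  by [].
have Dnat : m.+1%:R * D = \sum_(a < m.+1) D by rewrite sumr_const card_ord mulr_natl.
rewrite Dnat; apply: lerD; apply: ler_sum => a _.
- under eq_bigr do rewrite ger0_norm ?subr_ge0 ?iso//.
  rewrite all_ge0 (sum_ord_next (fun t => theta t a)) /D last_max.
  by apply: lerB; apply: iso => //=; have := ltn_ord a; lia.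
- under eq_bigr do rewrite ger0_norm ?subr_ge0 ?iso//.
  rewrite all_ge0 (sum_ord_next (fun t => theta a t)) /D last_max.
  by apply: lerB; apply: iso => //=; have := ltn_ord a; lia.
Qed.

(** * Multiscale windows and the flow to the uniform distribution *)

(** At scale [k], the points at distance less than [2 ^ k]. Such windows are
    symmetric in their two arguments, grow with [k], and keep between [2 ^ k]
    and [2 ^ k.+1] points even when truncated by the boundary, as long as
    [2 ^ k <= N]; dyadic blocks would need [N] to be a power of 2. *)
Definition window (N k : nat) (a b : 'I_N) : bool :=
  (a < b + 2 ^ k)%N && (b < a + 2 ^ k)%N.

Lemma windowC (N k : nat) (a b : 'I_N) : window k a b = window k b a.
Proof. by rewrite /window andbC. Qed.

Lemma windowS (N k : nat) (a b : 'I_N) : window k a b -> window k.+1 a b.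
Proof. by rewrite /window expnS; lia. Qed.

Definition window_card (N k : nat) (a : 'I_N) : nat := #|window k a|.

Lemma window_card_ge (N k : nat) (a : 'I_N) :
  (2 ^ k <= N)%N -> (2 ^ k <= window_card k a)%N.
Proof.
move=> kN.
(* The window contains [2 ^ k] consecutive points: those starting at [a] if
   they fit, the last ones otherwise. *)
pose s := if (a + 2 ^ k <= N)%N then a : nat else (N - 2 ^ k)%N.
rewrite -(size_iota s (2 ^ k)) /window_card cardE -(size_map val).
apply: uniq_leq_size; first exact: iota_uniq.
move=> i; rewrite mem_iota => /andP[si i_lt].
have iN : (i < N)%N by move: i_lt; rewrite /s; case: ifP; lia.
apply/mapP; exists (Ordinal iN) => //.
rewrite mem_enum unfold_in /window /=.
by move: (ltn_ord a) si i_lt; rewrite /s; case: ifP; lia.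
Qed.

Lemma window_card_le (N k : nat) (a : 'I_N) : (window_card k a <= 2 ^ k.+1)%N.
Proof.
rewrite -(size_iota (a.+1 - 2 ^ k) (2 ^ k.+1)) /window_card cardE -(size_map val).
apply: uniq_leq_size; first by rewrite (map_inj_uniq val_inj) enum_uniq.
move=> i /mapP[b]; rewrite mem_enum unfold_in /window => bw ->.
by rewrite mem_iota expnS /=; move: bw; lia.
Qed.

Lemma window_card_gt0 (N k : nat) (a : 'I_N) : (0 < window_card k a)%N.
Proof.
apply/card_gt0P; exists a; rewrite unfold_in /window.
have : (0 < 2 ^ k)%N by rewrite expn_gt0.
by lia.
Qed.

Lemma window_cardS (N k : nat) (a : 'I_N) :
  (window_card k a <= window_card k.+1 a)%N.
Proof. by apply/subset_leq_card/fintype.subsetP => b; exact: windowS. Qed.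

Definition window_weight (R : realType) (N k : nat) (a b : 'I_N) : R :=
  (window k a b)%:R / (window_card k a)%:R.

Lemma window_weight_ge0 (R : realType) (N k : nat) (a b : 'I_N) :
  0 <= window_weight R k a b.
Proof. by rewrite /window_weight divr_ge0. Qed.

Lemma sum_window_weight (R : realType) (N k : nat) (a : 'I_N) :
  \sum_b window_weight R k a b = 1.
Proof.
rewrite /window_weight -mulr_suml -natr_sum.
have -> : (\sum_(b < N) nat_of_bool (window k a b) = window_card k a)%N.
  rewrite /window_card -sum1_card [RHS]big_mkcond; apply: eq_bigr => b _.
  by rewrite -[b \in _]/(window k a b); case: window.
by rewrite divff// pnatr_eq0 -lt0n window_card_gt0.
Qed.

Lemma window_weight0 (R : realType) (N : nat) (a b : 'I_N) :
  window_weight R 0 a b = (b == a)%:R.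
Proof.
have win0 c : window 0 a c = (c == a).
  by rewrite /window expn0 -val_eqE /=; lia.
rewrite /window_weight win0 /window_card (eq_card win0) card1 divr1 //.
Qed.

Lemma window_weight_full (R : realType) (N k : nat) (a b : 'I_N) :
  (N <= 2 ^ k)%N -> window_weight R k a b = N%:R^-1.
Proof.
move=> Nk; have winT c : window k a c.
  by rewrite /window; have := ltn_ord a; have := ltn_ord c; lia.
by rewrite /window_weight winT /window_card (eq_card winT) card_ord div1r.
Qed.

Lemma window_weight_le (R : realType) (N k : nat) (a b : 'I_N) :
  (2 ^ k <= N)%N ->
  window_weight R k a b <= 2 ^- k * (window k a b)%:R.
Proof.
move=> kN; rewrite /window_weight mulrC ler_wpM2r// lef_pV2 ?posrE.
- by rewrite -natrX ler_nat window_card_ge.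
- by rewrite ltr0n window_card_gt0.
- by rewrite exprn_gt0.
Qed.

Lemma window_weightS_le (R : realType) (N k : nat) (a b : 'I_N) :
  (2 ^ k <= N)%N ->
  window_weight R k.+1 a b <= 2 ^- k * (window k.+1 a b)%:R.
Proof.
move=> kN; rewrite /window_weight mulrC ler_wpM2r// lef_pV2 ?posrE.
- by rewrite -natrX ler_nat (leq_trans (window_card_ge a kN) (window_cardS k a)).
- by rewrite ltr0n window_card_gt0.
- by rewrite exprn_gt0.
Qed.

(** The signed mass that crosses the edge following [t] when the uniform distribution on
    one window of [a] is transported to the uniform distribution on the
    next larger window. *)
Definition window_cdf_gap (R : realType) (N k : nat) (a t : 'I_N) : R :=
  \sum_(b < N | (b <= t)%N) (window_weight R k.+1 a b - window_weight R k a b).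

Lemma sum_window_weight_le1 (R : realType) (N k : nat) (a : 'I_N) (Q : pred 'I_N) :
  0 <= \sum_(b | Q b) window_weight R k a b <= 1.
Proof.
rewrite sumr_ge0 => [|b _]; last exact: window_weight_ge0.
rewrite -[leRHS](sum_window_weight R k a) [leRHS](bigID Q)/= lerDl sumr_ge0// => b _.
exact: window_weight_ge0.
Qed.

Lemma sum_window_weight_support (R : realType) (N k : nat) (a : 'I_N) (Q : pred 'I_N) :
  (forall b, window k a b -> Q b) ->
  \sum_(b | Q b) window_weight R k a b = 1.
Proof.
move=> kQ; rewrite -[RHS](sum_window_weight R k a) [RHS](bigID Q)/=.
rewrite [X in _ + X]big1 ?addr0// => b /negP nQ.
rewrite /window_weight; case: (boolP (window k a b)) => [/kQ//|_].
by rewrite mul0r.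
Qed.

Lemma sum_window_weight_disjoint (R : realType) (N k : nat) (a : 'I_N) (Q : pred 'I_N) :
  (forall b, Q b -> ~~ window k a b) ->
  \sum_(b | Q b) window_weight R k a b = 0.
Proof.
by move=> kQ; apply: big1 => b /kQ /negPf; rewrite /window_weight => ->; rewrite mul0r.
Qed.

(** A difference of two distribution functions is at most 1, and both functions are
    0 to the left of the larger window and 1 to the right of it. *)
Lemma window_cdf_gap_le (R : realType) (N k : nat) (a t : 'I_N) :
  `|window_cdf_gap R k a t| <= (window k.+1 a t)%:R.
Proof.
rewrite /window_cdf_gap sumrB.
case: (boolP (window k.+1 a t)) => [_|t_out].
  have /andP[] := sum_window_weight_le1 R k a (fun b => (b <= t)%N).
  have /andP[] := sum_window_weight_le1 R k.+1 a (fun b => (b <= t)%N).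
  by move=> /= ? ? ? ?; rewrite ler_norml mulr1n; lra.
have := t_out; rewrite negb_and -!leqNgt => /orP[lo|hi].
- rewrite !sum_window_weight_disjoint ?subrr ?normr0//.
  + by move=> b; rewrite /window; move: lo; rewrite expnS; lia.
  + by move=> b; rewrite /window; move: lo; rewrite expnS; lia.
- rewrite !sum_window_weight_support ?subrr ?normr0//.
  + by move=> b; rewrite /window; move: hi; rewrite expnS; lia.
  + by move=> b; rewrite /window; move: hi; rewrite expnS; lia.
Qed.

Lemma summation_by_parts_ord (R : realType) (m : nat) (u f : 'I_m.+1 -> R) :
  \sum_b u b = 0 ->
  \sum_b u b * f b =
  - \sum_(t < m.+1) (\sum_(b < m.+1 | (b <= t)%N) u b) * (f (ord_next t) - f t).
Proof.
move=> u0.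
transitivity (\sum_b (u b * f ord_max -
    \sum_(t < m.+1 | (b <= t)%N) u b * (f (ord_next t) - f t))).
  by apply: eq_bigr => b _; rewrite -mulr_sumr sum_ord_next; ring.
rewrite sumrB -mulr_suml u0 mul0r sub0r; congr (- _).
under eq_bigr do rewrite big_mkcond.
rewrite exchange_big/=; apply: eq_bigr => t _.
by rewrite mulr_suml -big_mkcond.
Qed.

Lemma window_average_diff (R : realType) (m k : nat) (a : 'I_m.+1)
    (f : 'I_m.+1 -> R) :
  \sum_b window_weight R k a b * f b - \sum_b window_weight R k.+1 a b * f b =
  \sum_t window_cdf_gap R k a t * (f (ord_next t) - f t).
Proof.
rewrite -sumrB; under eq_bigr do rewrite -mulrBl.
pose u b := window_weight R k a b - window_weight R k.+1 a b.
rewrite (@summation_by_parts_ord _ _ u f); last by rewrite sumrB !sum_window_weight subrr.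
rewrite -sumrN; apply: eq_bigr => t _; rewrite -mulNr -sumrN; congr (_ * _).
by apply: eq_bigr => b _; rewrite opprB.
Qed.

Definition window_mean (R : realType) (N k l : nat) (a b : 'I_N) (x : 'M[R]_N) : R :=
  \sum_i \sum_j window_weight R k a i * window_weight R l b j * x i j.

Lemma window_mean_diff_fst (R : realType) (m k l : nat) (a b : 'I_m.+1)
    (x : 'M[R]_m.+1) :
  window_mean k l a b x - window_mean k.+1 l a b x =
  \sum_t \sum_j window_cdf_gap R k a t * window_weight R l b j *
    (x (ord_next t) j - x t j).
Proof.
rewrite /window_mean exchange_big [X in _ - X]exchange_big [RHS]exchange_big/=.
rewrite -sumrB; apply: eq_bigr => j _.
transitivity (window_weight R l b j *
   (\sum_i window_weight R k a i * x i j - \sum_i window_weight R k.+1 a i * x i j)).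
  by rewrite mulrBr !mulr_sumr; congr (_ - _); apply: eq_bigr => i _; ring.
by rewrite window_average_diff mulr_sumr; apply: eq_bigr => t _; ring.
Qed.

Lemma window_mean_diff_snd (R : realType) (m k l : nat) (a b : 'I_m.+1)
    (x : 'M[R]_m.+1) :
  window_mean k l a b x - window_mean k l.+1 a b x =
  \sum_i \sum_t window_weight R k a i * window_cdf_gap R l b t *
    (x i (ord_next t) - x i t).
Proof.
rewrite /window_mean -sumrB; apply: eq_bigr => i _.
transitivity (window_weight R k a i *
   (\sum_j window_weight R l b j * x i j - \sum_j window_weight R l.+1 b j * x i j)).
  by rewrite mulrBr !mulr_sumr; congr (_ - _); apply: eq_bigr => j _; ring.
by rewrite window_average_diff mulr_sumr; apply: eq_bigr => t _; ring.
Qed.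

(** The two components of a flow sending a unit mass from the vertex [(a, b)] to
    the uniform distribution on the grid: at each scale the mass is spread
    first along the first coordinate, then along the second. *)
Definition flow_fst (R : realType) (N K : nat) (a b t j : 'I_N) : R :=
  \sum_(k < K) window_cdf_gap R k a t * window_weight R k b j.

Definition flow_snd (R : realType) (N K : nat) (a b i t : 'I_N) : R :=
  \sum_(k < K) window_weight R k.+1 a i * window_cdf_gap R k b t.

(** The flow gives a left inverse of the discrete gradient modulo constants:
    the averages over the windows of [(a, b)] telescope from the entry
    [x a b] at scale 0 to the global mean at scale [K]. *)
Lemma sub_mean_flow (R : realType) (m K : nat) (x : 'M[R]_m.+1) (a b : 'I_m.+1) :
  (m < 2 ^ K)%N ->
  x a b - (\sum_i \sum_j x i j) / (m.+1 ^ 2)%:R =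
  \sum_t \sum_j flow_fst R K a b t j * (x (ord_next t) j - x t j) +
  \sum_i \sum_t flow_snd R K a b i t * (x i (ord_next t) - x i t).
Proof.
move=> mK.
have -> : x a b = window_mean 0 0 a b x.
  rewrite /window_mean (bigD1 a)//= (bigD1 b)//= !window_weight0 !eqxx !mul1r.
  rewrite !big1 ?addr0// => [i /negPf ia|j /negPf jb].
    by apply: big1 => j _; rewrite window_weight0 ia !mul0r.
  by rewrite !window_weight0 jb mulr0 mul0r.
have -> : (\sum_i \sum_j x i j) / (m.+1 ^ 2)%:R = window_mean K K a b x.
  rewrite /window_mean mulr_suml; apply: eq_bigr => i _.
  rewrite mulr_suml; apply: eq_bigr => j _.
  by rewrite !window_weight_full// natrX expr2 invfM mulrC.
have -> : window_mean 0 0 a b x - window_mean K K a b x =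
    \sum_(k < K) ((window_mean k k a b x - window_mean k.+1 k a b x) +
                  (window_mean k.+1 k a b x - window_mean k.+1 k.+1 a b x)).
  rewrite -opprB -(telescope_sumr (fun k => window_mean k k a b x))//.
  rewrite big_mkord -sumrN; apply: eq_bigr => k _; ring.
rewrite big_split /=; congr (_ + _).
  under eq_bigr do rewrite window_mean_diff_fst.
  rewrite exchange_big; apply: eq_bigr => t _.
  rewrite exchange_big; apply: eq_bigr => j _.
  by rewrite /flow_fst mulr_suml.
under eq_bigr do rewrite window_mean_diff_snd.
rewrite exchange_big; apply: eq_bigr => t _.
rewrite exchange_big; apply: eq_bigr => j _.
by rewrite /flow_snd mulr_suml.
Qed.

(** Expanding the square, each cross term is dominated by the factor with the
    smaller index, and the remaining geometric series sums to a constant. *)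
Lemma sqr_geometric_sum (R : realType) (K : nat) (b : nat -> bool) :
  (\sum_(k < K) 2 ^- k * (b k)%:R) ^+ 2 <= 3 * \sum_(k < K) 4 ^- k * (b k)%:R :> R.
Proof.
pose A K (b : nat -> bool) : R := \sum_(k < K) 2 ^- k * (b k)%:R.
pose B K (b : nat -> bool) : R := \sum_(k < K) 4 ^- k * (b k)%:R.
(* The bound by 2 controls the cross term when the first index is split off. *)
have main : 0 <= A K b <= 2 /\ A K b ^+ 2 <= 3 * B K b; last exact: main.2.
elim: K b => [|K IHK] b; first by rewrite /A /B !big_ord0; split; lra.
have [/andP[A0 A2] AB] := IHK (fun k => b k.+1).
have -> : A K.+1 b = (b 0%N)%:R + 2^-1 * A K (fun k => b k.+1).
  rewrite /A big_ord_recl expr0 invr1 mul1r mulr_sumr; congr (_ + _).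
  by apply: eq_bigr => i _; rewrite /bump /= exprS invfM mulrA.
have -> : B K.+1 b = (b 0%N)%:R + 4^-1 * B K (fun k => b k.+1).
  rewrite /B big_ord_recl expr0 invr1 mul1r mulr_sumr; congr (_ + _).
  by apply: eq_bigr => i _; rewrite /bump /= exprS invfM mulrA.
by split; case: (b 0%N); rewrite ?mulr1n ?mulr0n; nra.
Qed.

(** The two-dimensional estimate. At scale [k] the flow through an edge is at
    most [2 ^- k] and comes from at most [16 * 4 ^ k] vertices, so that every
    scale contributes a constant to the sum of squares and the number [K] of scales,
    which is logarithmic in [N], is the whole bound. *)
Lemma sum_sqr_flow_bound (R : realType) (N K : nat) (t j : 'I_N)
    (g : 'I_N -> 'I_N -> R) :
  (forall a b, `|g a b| <=
     \sum_(k < K) 2 ^- k * (window k.+1 a t && window k.+1 b j)%:R) ->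
  \sum_a \sum_b g a b ^+ 2 <= 48 * K%:R.
Proof.
move=> g_le.
apply: (@le_trans _ _ (\sum_a \sum_b 3 * \sum_(k < K)
    4 ^- k * (window k.+1 a t && window k.+1 b j)%:R)).
  apply: ler_sum => a _; apply: ler_sum => b _.
  apply: (le_trans _ (sqr_geometric_sum R K
    (fun k => window k.+1 a t && window k.+1 b j))).
  by rewrite -real_normK ?num_real// ler_sqr ?nnegrE// (le_trans _ (g_le a b)).
have card_sum (k : nat) (c : 'I_N) : \sum_a (window k a c)%:R = (window_card k c)%:R :> R.
  rewrite -natr_sum; congr (_%:R).
  rewrite /window_card -sum1_card [RHS]big_mkcond; apply: eq_bigr => b _.
  by rewrite -[b \in _]/(window k c b) windowC; case: window.
have -> : \sum_a \sum_b 3 * (\sum_(k < K)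
    4 ^- k * (window k.+1 a t && window k.+1 b j)%:R) =
    3 * \sum_(k < K) 4 ^- k * ((window_card k.+1 t)%:R * (window_card k.+1 j)%:R) :> R.
  under eq_bigr do rewrite -mulr_sumr exchange_big.
  rewrite -mulr_sumr exchange_big; congr (_ * _); apply: eq_bigr => k _ /=.
  under eq_bigr do rewrite -mulr_sumr.
  rewrite -mulr_sumr -!card_sum mulr_suml; congr (_ * _); apply: eq_bigr => a _.
  by rewrite mulr_sumr; apply: eq_bigr => b _; rewrite -natrM mulnb.
rewrite (_ : 48 * K%:R = 3 * \sum_(k < K) 16); last first.
  rewrite sumr_const card_ord -mulr_natr; ring.
rewrite ler_pM2l//; apply: ler_sum => k _.
rewrite mulrC ler_pdivrMr ?exprn_gt0//.
rewrite -natrM -natrX -natrM ler_nat.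
apply: (@leq_trans (2 ^ k.+2 * 2 ^ k.+2)); first by rewrite leq_mul// window_card_le.
by rewrite -expnD -(expnM 2 2) -(expnD 2 4) leq_exp2l//; lia.
Qed.

Lemma sum_sqr_flow_fst (R : realType) (N K : nat) (t j : 'I_N) :
  (forall k, (k < K)%N -> (2 ^ k <= N)%N) ->
  \sum_a \sum_b flow_fst R K a b t j ^+ 2 <= 48 * K%:R.
Proof.
move=> KN; apply: (@sum_sqr_flow_bound _ _ _ t j) => a b.
apply: le_trans (ler_norm_sum _ _ _) _; apply: ler_sum => k _.
rewrite normrM [X in _ * X]ger0_norm ?window_weight_ge0//.
have := window_cdf_gap_le R k a t.
have := window_weight_le R b j (KN k (ltn_ord k)).
have := window_weight_ge0 R k b j.
have p : 0 < 2 ^- k :> R by rewrite invr_gt0 exprn_gt0.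
case: (boolP (window k b j)) => [/windowS ->|_]; case: (window _ a t);
  case: (window k.+1 b j); rewrite ?(mulr1n, mulr0n, mulr0, mulr1) => ? ? ?; nra.
Qed.

Lemma sum_sqr_flow_snd (R : realType) (N K : nat) (i t : 'I_N) :
  (forall k, (k < K)%N -> (2 ^ k <= N)%N) ->
  \sum_a \sum_b flow_snd R K a b i t ^+ 2 <= 48 * K%:R.
Proof.
move=> KN; apply: (@sum_sqr_flow_bound _ _ _ i t) => a b.
apply: le_trans (ler_norm_sum _ _ _) _; apply: ler_sum => k _.
rewrite normrM ger0_norm ?window_weight_ge0//.
have := window_cdf_gap_le R k b t.
have := window_weightS_le R a i (KN k (ltn_ord k)).
have := window_weight_ge0 R k.+1 a i.
have p : 0 < 2 ^- k :> R by rewrite invr_gt0 exprn_gt0.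
case: (window _ a i); case: (window _ b t);
  rewrite ?(mulr1n, mulr0n, mulr0, mulr1) => ? ? ?; nra.
Qed.

(** * Noise against total variation *)

Lemma sum_mul_sum_exchange (R : realType) (I J : finType) (e : I -> R) (f : I -> J -> R)
    (D : J -> R) :
  \sum_p e p * (\sum_q f p q * D q) = \sum_q (\sum_p f p q * e p) * D q.
Proof.
under eq_bigr do rewrite mulr_sumr.
rewrite exchange_big; apply: eq_bigr => q _ /=.
by rewrite mulr_suml; apply: eq_bigr => p _; ring.
Qed.

(** Summation by parts along the flow moves the noise from the entries of [x] to
    the edges of the grid, except for the mean of [x]; there a
    completed square leaves only the squared sum of the noise divided by the number of entries. *)
Lemma mxdot_noise_le (R : realType) (m K : nat) (eps x : 'M[R]_m.+1) (tau : R) :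
  (m < 2 ^ K)%N ->
  (forall t j, `|\sum_(p : 'I_m.+1 * 'I_m.+1)
     flow_fst R K p.1 p.2 t j * eps p.1 p.2| <= tau) ->
  (forall i t, `|\sum_(p : 'I_m.+1 * 'I_m.+1)
     flow_snd R K p.1 p.2 i t * eps p.1 p.2| <= tau) ->
  2 * mxdot eps x <= mxdot x x +
    (\sum_(p : 'I_m.+1 * 'I_m.+1) eps p.1 p.2) ^+ 2 / (m.+1 ^ 2)%:R +
    2 * tau * grid_tv x.
Proof.
move=> mK fst_le snd_le.
set n : R := (m.+1 ^ 2)%:R; set E := \sum_p _.
have n0 : 0 < n by rewrite ltr0n.
pose S := \sum_i \sum_j x i j.
have square : 2 * (E * (S / n)) <= mxdot x x + E ^+ 2 / n.
  have := mxdot_ge0 (x - const_mx (E / n)).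
  rewrite !mxdotE [mxdot (const_mx _) x]mxdotC.
  have -> : mxdot x (const_mx (E / n)) = E * (S / n).
    rewrite [RHS]mulrCA /mxdot /S [RHS]mulr_suml; apply: eq_bigr => i _.
    by rewrite [RHS]mulr_suml; apply: eq_bigr => j _; rewrite mxE.
  have -> : mxdot (const_mx (E / n) : 'M[R]_m.+1) (const_mx (E / n)) = E ^+ 2 / n.
    transitivity (\sum_(i < m.+1) \sum_(j < m.+1) (E / n * (E / n))).
      by rewrite /mxdot; do 2 (apply: eq_bigr => ? _); rewrite !mxE.
    rewrite !sumr_const card_ord -mulrnA -[in LHS]mulr_natr -/n.
    by rewrite /n -mulnn -/n; field; rewrite gt_eqF.
  by move: (E * (S / n)) (E ^+ 2 / n) (mxdot x x) => ? ? ?; lra.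
have split_dot : mxdot eps x = E * (S / n) +
    (\sum_(q : 'I_m.+1 * 'I_m.+1)
      (\sum_(p : 'I_m.+1 * 'I_m.+1) flow_fst R K p.1 p.2 q.1 q.2 * eps p.1 p.2) *
      (x (ord_next q.1) q.2 - x q.1 q.2) +
     \sum_(q : 'I_m.+1 * 'I_m.+1)
      (\sum_(p : 'I_m.+1 * 'I_m.+1) flow_snd R K p.1 p.2 q.1 q.2 * eps p.1 p.2) *
      (x q.1 (ord_next q.2) - x q.1 q.2)).
  rewrite -!sum_mul_sum_exchange /mxdot pair_bigA /= -big_split /E mulr_suml.
  rewrite -big_split; apply: eq_bigr => p _ /=.
  rewrite -!mulrDr; congr (_ * _).
  have := sub_mean_flow x p.1 p.2 mK; rewrite !pair_bigA /= => <-.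
  by rewrite /S pair_bigA /n; ring.
rewrite split_dot grid_tvE pair_bigA /= big_split /=.
set A := \sum_(q : 'I_m.+1 * 'I_m.+1) _ * _; set B := \sum_(q : 'I_m.+1 * 'I_m.+1) _ * _.
set A' := \sum_(q : 'I_m.+1 * 'I_m.+1) `| _ |; set B' := \sum_(q : 'I_m.+1 * 'I_m.+1) `| _ |.
have AA' : A <= tau * A'.
  rewrite mulr_sumr; apply: ler_sum => q _; apply: le_trans (ler_norm _) _.
  by rewrite normrM ler_wpM2r.
have BB' : B <= tau * B'.
  rewrite mulr_sumr; apply: ler_sum => q _; apply: le_trans (ler_norm _) _.
  by rewrite normrM ler_wpM2r.
move: square AA' BB'; move: (E * (S / n)) (E ^+ 2 / n) (mxdot x x).
by move=> ? ? ? ? ? ?; lra.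
Qed.

(** An estimator that is a 1-Lipschitz function of the noise is continuous in it,
    so its distance to a point exceeds a threshold on an open set of noise values. *)
Lemma measurable_nonexpansive_ball (R : realType) (d : measure_display)
    (T : measurableType d) (P : probability T R) (I : finType)
    (X : I -> {RV P >-> R}) (N : nat) (hat : T -> 'M[R]_N) (star : 'M[R]_N) (k B : R) :
  0 < k ->
  (forall w w', mxdot (hat w' - hat w) (hat w' - hat w)
     <= \sum_i (X i w' - X i w) ^+ 2) ->
  measurable [set w | k * l2norm (hat w - star) ^+ 2 <= B].
Proof.
move=> k0 nonexp.
have -> : [set w | k * l2norm (hat w - star) ^+ 2 <= B] =
    ~` [set w | B / k < mxdot (hat w - star) (hat w - star)].
  apply/seteqP; split => w /=; rewrite l2norm_sqr ltNge ler_pdivlMr// mulrC.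
    by move=> ->.
  by move=> /negP; rewrite negbK.
apply: measurableC; apply: (measurable_open_in_rvs (X := X)) => w /=.
set b := B / k; set A := mxdot _ _ => bA.
have [b0|b0] := ltP b 0.
  exists 1 => // w' _; exact: lt_le_trans b0 (mxdot_ge0 _).
have A0 : 0 < A by exact: le_lt_trans b0 bA.
(* From [0 <= |q + s p|^2], with [p] and [q] the error at [w] and the increment,
   [|p + q|^2 >= (1 - s) * A - |q|^2 / s], which exceeds [b] for this [s]
   and small [q]. *)
pose s := (A - b) / (2 * A).
have s0 : 0 < s by rewrite divr_gt0 ?subr_gt0// mulr_gt0.
have sA : s * A = (A - b) / 2 by rewrite /s; field; rewrite gt_eqF.
exists (s * ((A - b) / 2)); first by rewrite mulr_gt0// divr_gt0// subr_gt0.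
move=> w' /(le_lt_trans (nonexp w w')).
have := mxdot_ge0 ((hat w' - hat w) + s *: (hat w - star)).
have -> : hat w' - star = (hat w' - hat w) + (hat w - star).
  by apply/matrixP => i j; rewrite !mxE; ring.
have := erefl A; rewrite {1}/A.
move: (hat w - star) (hat w' - hat w) => p q.
rewrite !mxdotE [mxdot p q]mxdotC => -> h1 h2.
have h3 : 0 <= s * (s * A) + 2 * s * mxdot q p + mxdot q q by lra.
rewrite -(ltr_pM2l s0).
have : 0 <= mxdot q q by exact: mxdot_ge0.
nra.
Qed.

(** * Logarithms *)

Lemma ln2_ge_half (R : realType) : 1 / 2 <= ln 2 :> R.
Proof.
have := @le_ln1Dx R (- (1 / 2)).
rewrite (_ : 1 - 1 / 2 = 2^-1); last by lra.
by rewrite lnV ?posrE// => ln_le; have h : -1 < - (1 / 2) :> R; [lra|move: (ln_le h); lra].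
Qed.

Lemma leq_exp_scale (N k : nat) :
  (1 < N)%N -> (k < up_log 2 N)%N -> (2 ^ k <= N)%N.
Proof.
move=> hN kK; have lt_N := up_log_gtn (isT : (1 < 2)%N) hN.
apply: leq_trans (ltnW lt_N); rewrite leq_exp2l//.
by move: kK; case: up_log.
Qed.

(** Uses [2 ^ K <= 2 * N <= N ^ 2] for the least [K] with [N <= 2 ^ K]. *)
Lemma scale_count_le_ln (R : realType) (N : nat) : (1 < N)%N ->
  (up_log 2 N)%:R <= 2 * ln (N ^ 2)%:R :> R.
Proof.
move=> hN; have K_gt0 : (0 < up_log 2 N)%N by rewrite up_log_gt0.
have le_sqr : (2 ^ up_log 2 N <= N ^ 2)%N.
  rewrite -(prednK K_gt0) expnS -mulnn leq_mul// ltnW//.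
  exact: up_log_gtn.
have : ln (2 ^ up_log 2 N)%:R <= ln (N ^ 2)%:R :> R.
  by rewrite ler_ln ?posrE ?ltr0n ?expn_gt0 ?(ltnW hN)// ler_nat.
rewrite (natrX _ 2) lnXn// -[X in X <= _]mulr_natl.
have := ler_wpM2l (ler0n R (up_log 2 N)) (ln2_ge_half R).
lra.
Qed.

Lemma ln_sqr_ge1 (R : realType) (N : nat) : (1 < N)%N -> 1 <= ln (N ^ 2)%:R :> R.
Proof.
move=> hN; have h2 := ln2_ge_half R.
have : ln (2 : R) <= ln N%:R.
  by rewrite ler_ln ?posrE ?ltr0n ?(ltnW hN)// ler_nat.
rewrite natrX lnXn ?ltr0n ?(ltnW hN)//; lra.
Qed.

Lemma expR1_ge2 (R : realType) : 2 <= expR 1 :> R.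
Proof. by have := expR_ge1Dx (1 : R); lra. Qed.

(** Replaces the logarithm in the tuning parameter, which has the extra factor [expR 1], by
    the one in the risk bound: [1 + l <= 4 * l] for [l = ln (n / delta)], as [l >= 1]. *)
Lemma sqrt_log_rate_le (R : realType) (N : nat) (n delta : R) :
  (1 < N)%N -> n = (N ^ 2)%:R -> 0 < delta -> delta < 1 ->
  Num.sqrt (ln n * ln (expR 1 * n / delta)) / n * N%:R <=
  2 * Num.sqrt (ln n * ln (n / delta) / n).
Proof.
move=> hN n_def d0 d1; have N0 : 0 < N%:R :> R by rewrite ltr0n ltnW.
have nE : n = N%:R ^+ 2 by rewrite n_def natrX.
have n0 : 0 < n by rewrite nE exprn_gt0.
have lnn : 1 <= ln n by rewrite n_def ln_sqr_ge1.
have l1 : 1 <= ln (n / delta).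
  apply: le_trans lnn _; rewrite ler_ln ?posrE ?divr_gt0// ler_pdivlMr//.
  by rewrite ler_piMr ?ltW.
have -> : ln (expR 1 * n / delta) = 1 + ln (n / delta).
  by rewrite -mulrA lnM ?posrE ?expR_gt0 ?divr_gt0// expRK.
rewrite [X in _ <= 2 * X]sqrtrM; last by rewrite mulr_ge0//; lra.
have -> : Num.sqrt n^-1 = N%:R^-1.
  by rewrite sqrtrV ?ltW// nE sqrtr_sqr gtr0_norm.
rewrite -mulrA (_ : n^-1 * N%:R = N%:R^-1); last first.
  by rewrite nE; field; rewrite gt_eqF.
rewrite mulrA ler_wpM2r ?invr_ge0//.
rewrite (_ : 2 = Num.sqrt 4); last first.
  by rewrite (_ : 4 = 2 ^+ 2) ?sqrtr_sqr ?ger0_norm//; ring.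
by rewrite -sqrtrM// ler_sqrt; nra.
Qed.

(** * The risk bound *)

Unset Implicit Arguments.

Theorem proposition25 (R : realType) :
  exists c C : R, 0 < c /\ 0 < C /\
  forall (N : nat) (hN : (1 < N)%N) (sigma delta : R)
    (thetastar thetaup : 'M[R]_N)
    (d : measure_display) (T : measurableType d) (P : probability T R)
    (eps : 'I_N * 'I_N -> {RV P >-> R}) (y thetahat : T -> 'M[R]_N),
  let n : R := (N ^ 2)%:R in
  let e : R := expR 1 in
  let lambda : R := c * sigma * Num.sqrt (ln n * ln (e * n / delta)) / n in
  0 < sigma -> 0 < delta -> delta < 1 ->
  isotropic_gaussian sigma eps ->
  (forall w, y w = thetastar + \matrix_(i < N, j < N) eps (i, j) w) ->
  is_euclidean_proj (@bi_isotonic R N) thetastar thetaup ->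
  (forall w, is_argmin (tv_objective lambda (y w)) (thetahat w)) ->
  ((1 - 2 * delta)%:E <=
    P [set w | (n^-1 * l2norm (thetahat w - thetastar) ^+ 2 <=
                n^-1 * l2norm (thetaup - thetastar) ^+ 2
                + C * sigma * Num.sqrt (ln n * ln (n / delta) / n)
                  * Num.sqrt (square_variation (ltnW hN) thetaup)
                + C * (sigma ^+ 2 / n) * ln (e / delta))%R])%E.
Proof.
(* The risk bound contains [2 * lambda] times a total variation of at most [2 * N] times
   the square root of the square variation: this is [160 = 4 * 40], and
   [sqrt_log_rate_le] costs a factor 2. *)
exists 40, 320; split; first by rewrite ltr0n.
split; first by rewrite ltr0n.
move=> [//|m] hN sigma delta star up d T P eps y hat n e lambda.
move=> sigma0 d0 d1 gauss yE [up_iso _] hatmin.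
set C : R := 320; set goal_set := [set w | _].
have n_ge1 : 1 <= n by rewrite /n ler1n.
have n0 : 0 < n by lra.
have e2 : 2 <= e by exact: expR1_ge2.
have e0 : 0 < e by lra.
have lnn : 1 <= ln n by exact: ln_sqr_ge1.
pose L := ln (e * n / delta).
have en_d : 0 < e * n / delta by rewrite divr_gt0// mulr_gt0.
have L0 : 0 < L.
  rewrite ln_gt0// ltr_pdivlMr// mul1r; nra.
pose l := ln (e / delta).
have e_d : 0 < e / delta by rewrite divr_gt0.
have l0 : 0 < l by rewrite ln_gt0// ltr_pdivlMr// mul1r; lra.
have lambda0 : 0 <= lambda.
  by rewrite /lambda divr_ge0 ?mulr_ge0 ?sqrtr_ge0// ltW.
pose K := up_log 2 m.+1.
have mK : (m < 2 ^ K)%N by exact: up_logP.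
have Km k : (k < K)%N -> (2 ^ k <= m.+1)%N by exact: leq_exp_scale.
have K_le : 48 * K%:R <= 100 * ln n.
  have := scale_count_le_ln R hN; rewrite -/K -/n; lra.
have objective w : is_argmin (fun u => n^-1 * l2norm (u - y w) ^+ 2 +
    lambda * grid_tv u) (hat w) by exact: hatmin.
have lambda_convex := segment_convexZ lambda0 (@grid_tv_convex R m.+1).
have goal_measurable : measurable goal_set.
  apply: (measurable_nonexpansive_ball (X := eps)); first by rewrite invr_gt0.
  move=> w w'.
  have ninv : 0 < n^-1 by rewrite invr_gt0.
  apply: le_trans (penalized_argmin_nonexpansive ninv lambda_convex (objective w)
    (objective w')) _.
  rewrite !yE /mxdot pair_bigA /=; apply: ler_sum => -[i j] _ /=.
  by rewrite !mxE expr2 !opprD addrACA subrr add0r.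
(* Half of the tuning parameter times [n]; with the variance bound [100 * ln n]
   it gives the tail exponent exactly [2 * L]. *)
pose tau := 20 * sigma * Num.sqrt (ln n * L).
have tau0 : 0 < tau.
  by rewrite !mulr_gt0// sqrtr_gt0 mulr_gt0//; lra.
have tau_lambda : 2 * n^-1 * tau <= lambda.
  by rewrite /tau /lambda -/L le_eqVlt; apply/orP; left; apply/eqP; field; rewrite gt_eqF.
(* Chosen so that the tail exponent of the sum of all noise entries is [l]. *)
pose s := sigma * Num.sqrt (2 * n * l).
have s0 : 0 < s by rewrite mulr_gt0// sqrtr_gt0 !mulr_gt0.
(* The Boolean selects one of the two directions of edges. *)
pose coef (q : bool * ('I_m.+1 * 'I_m.+1)) (p : 'I_m.+1 * 'I_m.+1) : R :=
  if q.1 then flow_fst R K p.1 p.2 q.2.1 q.2.2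
  else flow_snd R K p.1 p.2 q.2.1 q.2.2.
have coef_le q : \sum_p coef q p ^+ 2 <= 100 * ln n.
  apply: le_trans K_le; rewrite /coef; case: q => -[] [t j] /=.
    by have := sum_sqr_flow_fst R t j Km; rewrite pair_bigA.
  by have := sum_sqr_flow_snd R t j Km; rewrite pair_bigA.
have v0 : 0 < 100 * ln n by lra.
have [mflow Pflow] := gaussian_linear_forms_tail sigma0 gauss v0 coef_le tau0.
have one_le : \sum_(p : 'I_m.+1 * 'I_m.+1) (1 : R) ^+ 2 <= n.
  by under eq_bigr do rewrite expr1n; rewrite sumr_const card_prod card_ord.
have [mmean Pmean] := gaussian_linear_form_tail sigma0 gauss n0 one_le s0.
set bad1 := [set w | exists k, _] in mflow Pflow.
set bad2 := [set w | s <= _] in mmean Pmean.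
have Pbad1 : (P bad1 <= delta%:E)%E.
  apply: le_trans Pflow _; rewrite lee_fin.
  have -> : tau ^+ 2 / (2 * sigma ^+ 2 * (100 * ln n)) = 2%:R * L.
    rewrite exprMn sqr_sqrtr ?mulr_ge0 ?ltW//; last by lra.
    by field; rewrite !gt_eqF//; lra.
  rewrite expRN expRM_natl lnK ?posrE// !card_prod card_bool card_ord.
  rewrite natrM mulnn -/n.
  have -> : 2%:R * n * (2 * (e * n / delta) ^- 2) = delta * (4 * delta / (e ^+ 2 * n)).
    by field; rewrite !gt_eqF.
  rewrite ger_pMr// ler_pdivrMr ?mulr_gt0 ?exprn_gt0// mul1r; nra.
have Pbad2 : (P bad2 <= delta%:E)%E.
  apply: le_trans Pmean _; rewrite lee_fin.
  have -> : s ^+ 2 / (2 * sigma ^+ 2 * n) = l.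
    rewrite exprMn sqr_sqrtr ?mulr_ge0 ?ltW//.
    by field; rewrite !gt_eqF.
  rewrite expRN lnK ?posrE// invf_div mulrCA ger_pMr// ler_pdivrMr// mul1r.
  exact: e2.
have mbad : measurable (bad1 `|` bad2) by exact: measurableU.
have Pbad : (P (bad1 `|` bad2) <= (2 * delta)%:E)%E.
  apply: le_trans (measureU2 _ _ _) _ => //.
  by rewrite mulr2n mulrDl mul1r EFinD leeD.
apply: (@le_trans _ _ (P (~` (bad1 `|` bad2)))).
  by rewrite probability_setC// EFinB leeB.
apply: le_measure; rewrite ?inE//; first exact: measurableC.
move=> w /= not_bad; rewrite /goal_set /=.
pose E0 : 'M[R]_m.+1 := \matrix_(i, j) eps (i, j) w.
have E0E p : E0 p.1 p.2 = eps p w by rewrite mxE -surjective_pairing.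
have flow_small q : `|\sum_p coef q p * eps p w| <= tau.
  rewrite leNgt; apply/negP => lt_tau; apply: not_bad; left; exists q.
  exact: ltW.
have mean_small : `|\sum_p eps p w| <= s.
  rewrite leNgt; apply/negP => lt_s; apply: not_bad; right; rewrite /bad2 /=.
  by under eq_bigr do rewrite mul1r; exact: ltW.
have noise x : 2 * mxdot E0 x <= mxdot x x +
    (\sum_p E0 p.1 p.2) ^+ 2 / n + 2 * tau * grid_tv x.
  apply: (mxdot_noise_le (K := K)) => // t j.
    have := flow_small (true, (t, j)).
    by rewrite /coef /=; under eq_bigr do rewrite -E0E.
  have := flow_small (false, (t, j)).
  by rewrite /coef /=; under eq_bigr do rewrite -E0E.
have ninv : 0 <= n^-1 by rewrite invr_ge0 ltW.
have hat_min : is_argmin (fun u => n^-1 * l2norm (u - (star + E0)) ^+ 2 +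
    lambda * grid_tv u) (hat w) by rewrite -[star + E0]yE.
apply: le_trans (penalized_oracle_inequality up ninv lambda0 tau_lambda
  (@grid_tv_ge0 R _) (@grid_tvB R _) (@grid_tv_convex R _) noise hat_min) _.
rewrite -addrA -[leRHS]addrA lerD2l; apply: lerD.
- have tv_up := grid_tv_bi_isotonic (ltnW hN) up_iso.
  set V := Num.sqrt (square_variation _ _) in tv_up *.
  have V0 : 0 <= V by exact: sqrtr_ge0.
  apply: (@le_trans _ _ (2 * lambda * (2 * m.+1%:R * V))).
    by apply: ler_wpM2l tv_up; apply: mulr_ge0.
  rewrite (_ : 2 * lambda * (2 * m.+1%:R * V) =
    160 * sigma * (Num.sqrt (ln n * L) / n * m.+1%:R) * V); last first.
    by rewrite /lambda -/L; field; rewrite gt_eqF.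
  rewrite ler_wpM2r// (_ : C * sigma * _ =
    160 * sigma * (2 * Num.sqrt (ln n * ln (n / delta) / n))); last first.
    by rewrite /C; ring.
  apply: ler_wpM2l; first by rewrite mulr_ge0// ltW.
  exact: sqrt_log_rate_le.
- under eq_bigr do rewrite E0E.
  have : (\sum_p eps p w) ^+ 2 <= s ^+ 2.
    by rewrite -real_normK ?num_real// ler_sqr ?nnegrE// ltW.
  have nl0 : 0 <= 2 * n * l by rewrite !mulr_ge0// ltW.
  rewrite [s ^+ 2]exprMn sqr_sqrtr// => mean_sqr.
  apply: (@le_trans _ _ (n^-1 * (sigma ^+ 2 * (2 * n * l) / n))).
    by apply: ler_wpM2l => //; apply: ler_wpM2r.
  rewrite (_ : n^-1 * _ = 2 * (sigma ^+ 2 / n) * l); last first.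
    by field; rewrite gt_eqF.
  rewrite -/l ler_wpM2r ?(ltW l0)// ler_wpM2r ?divr_ge0 ?sqr_ge0 ?(ltW n0)//.
  by rewrite /C; lra.
Qed.
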